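(* Every object in a Grothendieck category $\mathcal D$ has an injective hull.
   Context: $\mathcal D$ is considered with the abelian exact structure (all short exact sequences). An injective hull of an object $X$ is a monomorphism $u : X \to E$ with $E$ injective which is essential: for any morphism $f : E \to Z$ such that $fu$ is a monomorphism, $f$ is a monomorphism. *)

(* Defs.v *)
From mathcomp Require Import all_boot all_algebra.

Set Implicit Arguments.
Unset Strict Implicit.
Unset Printing Implicit Defensive.

Import GRing.Theory.
Local Open Scope ring_scope.

(* "Small" means: in the universe in which the carriers of zmodTypes live.
   Below, the hom groups of a category are zmodTypes, so its hom sets are small,
   while its objects may form a type of any size. Index categories have their
   objects and arrows in the same universe as the hom sets; indexing colimits by
   a strictly larger universe would make cocompleteness degenerate. *)
Notation smallType := Type@{Algebra.Zmodule.axioms_.u0} (only parsing).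

Record smallCat := SmallCat {
  sob :> smallType;
  shom : sob -> sob -> smallType;
  sid : forall i, shom i i;
  scomp : forall i j k, shom j k -> shom i j -> shom i k;
  scompA : forall i j k l (h : shom k l) (g : shom j k) (f : shom i j),
    scomp h (scomp g f) = scomp (scomp h g) f;
  scomp1l : forall i j (f : shom i j), scomp (sid j) f = f;
  scomp1r : forall i j (f : shom i j), scomp f (sid i) = f }.

Record preaddCat := PreaddCat {
  ob :> Type;
  mor : ob -> ob -> zmodType;
  idmor : forall A, mor A A;
  compm : forall A B C, mor B C -> mor A B -> mor A C;
  compmA : forall A B C D (h : mor C D) (g : mor B C) (f : mor A B),
    compm h (compm g f) = compm (compm h g) f;
  compm1l : forall A B (f : mor A B), compm (idmor B) f = f;
  compm1r : forall A B (f : mor A B), compm f (idmor A) = f;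
  compmDl : forall A B C (g g' : mor B C) (f : mor A B),
    compm (g + g') f = compm g f + compm g' f;
  compmDr : forall A B C (g : mor B C) (f f' : mor A B),
    compm g (f + f') = compm g f + compm g f' }.

Arguments idmor {p} A.

Notation "g \oc f" := (compm g f) (at level 40, left associativity).

Section Notions.
Context {D : preaddCat}.
Implicit Types A B C E P U W X Z : D.

Definition mono A B (f : mor A B) : Prop :=
  forall W (g h : mor W A), f \oc g = f \oc h -> g = h.

Definition epi A B (f : mor A B) : Prop :=
  forall W (g h : mor B W), g \oc f = h \oc f -> g = h.

(* Existence of the unique morphisms is automatic: hom groups contain 0. *)
Definition is_zero_object Z : Prop :=
  (forall A (f : mor A Z), f = 0) /\ (forall A (f : mor Z A), f = 0).

Definition is_biproduct A B P (i1 : mor A P) (i2 : mor B P)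
    (p1 : mor P A) (p2 : mor P B) : Prop :=
  [/\ p1 \oc i1 = idmor A, p2 \oc i2 = idmor B, p2 \oc i1 = 0, p1 \oc i2 = 0
    & i1 \oc p1 + i2 \oc p2 = idmor P].

Definition is_kernel A B C (g : mor B C) (f : mor A B) : Prop :=
  g \oc f = 0 /\
  forall W (t : mor W B), g \oc t = 0 -> exists! s : mor W A, f \oc s = t.

Definition is_cokernel A B C (f : mor A B) (g : mor B C) : Prop :=
  g \oc f = 0 /\
  forall W (t : mor B W), t \oc f = 0 -> exists! s : mor C W, s \oc g = t.

Definition short_exact A B C (f : mor A B) (g : mor B C) : Prop :=
  is_kernel g f /\ is_cokernel f g.

(* Generator in the sense that Hom(U, -) is faithful. *)
Definition is_generator U : Prop :=
  forall A B (f g : mor A B), (forall h : mor U A, f \oc h = g \oc h) -> f = g.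

Definition injective_object E : Prop :=
  forall A B (i : mor A B), mono i ->
  forall f : mor A E, exists g : mor B E, g \oc i = f.

Definition essential X E (u : mor X E) : Prop :=
  forall Z (f : mor E Z), mono (f \oc u) -> mono f.

Definition injective_hull X E (u : mor X E) : Prop :=
  [/\ mono u, injective_object E & essential u].

End Notions.

Record is_abelian (D : preaddCat) : Prop := Abelian {
  abelian_zero : exists Z : D, is_zero_object Z;
  abelian_biproduct : forall A B : D,
    exists (P : D) (i1 : mor A P) (i2 : mor B P) (p1 : mor P A) (p2 : mor P B),
      is_biproduct i1 i2 p1 p2;
  abelian_kernel : forall (B C : D) (g : mor B C),
    exists (A : D) (f : mor A B), is_kernel g f;
  abelian_cokernel : forall (A B : D) (f : mor A B),
    exists (C : D) (g : mor B C), is_cokernel f g;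
  abelian_mono : forall (A B : D) (f : mor A B), mono f ->
    exists (C : D) (g : mor B C), is_kernel g f;
  abelian_epi : forall (B C : D) (g : mor B C), epi g ->
    exists (A : D) (f : mor A B), is_cokernel f g }.

Record functor (J : smallCat) (D : preaddCat) := Functor {
  fob :> J -> D;
  fmap : forall i j, shom i j -> mor (fob i) (fob j);
  fmap_id : forall i, fmap (sid i) = idmor (fob i);
  fmap_comp : forall i j k (g : shom j k) (f : shom i j),
    fmap (scomp g f) = fmap g \oc fmap f }.

Arguments fmap {J D} f {i j} : rename.

Record natTrans (J : smallCat) (D : preaddCat) (F G : functor J D) := NatTrans {
  ntm :> forall i, mor (F i) (G i);
  ntmP : forall i j (f : shom i j), ntm j \oc fmap F f = fmap G f \oc ntm i }.

Record cocone (J : smallCat) (D : preaddCat) (F : functor J D) := Cocone {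
  apex : D;
  leg : forall i, mor (F i) apex;
  legP : forall i j (f : shom i j), leg j \oc fmap F f = leg i }.

Definition is_colimit (J : smallCat) (D : preaddCat) (F : functor J D)
    (c : cocone F) : Prop :=
  forall c' : cocone F,
    exists! h : mor (apex c) (apex c'), forall i, h \oc leg c i = leg c' i.

Definition cocomplete (D : preaddCat) : Prop :=
  forall (J : smallCat) (F : functor J D), exists c : cocone F, is_colimit c.

Record filtered (J : smallCat) : Prop := Filtered {
  filtered_nonempty : exists i : J, True;
  filtered_ub : forall i j : J,
    exists (k : J) (f : shom i k) (g : shom j k), True;
  filtered_coeq : forall (i j : J) (f g : shom i j),
    exists (k : J) (h : shom j k), scomp h f = scomp h g }.

(* a and b below are the morphisms induced by alpha and beta on the colimits. *)
Definition exact_filtered_colimits (D : preaddCat) : Prop :=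
  forall (J : smallCat), filtered J ->
  forall (F G H : functor J D) (alpha : natTrans F G) (beta : natTrans G H),
  (forall i, short_exact (alpha i) (beta i)) ->
  forall (cF : cocone F) (cG : cocone G) (cH : cocone H),
  is_colimit cF -> is_colimit cG -> is_colimit cH ->
  forall (a : mor (apex cF) (apex cG)) (b : mor (apex cG) (apex cH)),
  (forall i, a \oc leg cF i = leg cG i \oc alpha i) ->
  (forall i, b \oc leg cG i = leg cH i \oc beta i) ->
  short_exact a b.

Record is_grothendieck (D : preaddCat) : Prop := Grothendieck {
  grothendieck_abelian : is_abelian D;
  grothendieck_cocomplete : cocomplete D;
  grothendieck_exact : exact_filtered_colimits D;
  grothendieck_generator : exists U : D, is_generator U }.

(* Main.v *)
(* An object all of whose essential extensions split is injective: given
   A -> B mono and A -> E, let P be the pushout; a maximal quotient P -> Q with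
   E -> Q mono makes Q an essential extension of E, and a retraction Q -> E
   gives the extension of A -> E to B. Essential extensions compose, so it
   suffices to find a maximal essential extension of X. By exactness of filtered
   colimits, the colimit of a chain of essential extensions is one; Zorn's lemma
   applies since the sets Hom(U, E), for U a generator and E essential over X,
   are bounded in size. The bound is of Erdos-Rado type: the pairs of elements
   of Hom(U, E) are coloured, with a small set of colours depending only on U
   and X, in such a way that there is no monochromatic triangle. *)

Require Import Defs.
From mathcomp Require Import all_boot all_algebra.
From mathcomp Require Import boolp wochoice.

Set Implicit Arguments.
Unset Strict Implicit.
Unset Printing Implicit Defensive.

Import GRing.Theory.
Local Open Scope ring_scope.

(** * Monos and epis in preadditive categories *)

Section Preadditive.
Context {D : preaddCat}.
Implicit Types A B C U W : D.

Lemma comp0m A B C (f : mor A B) : (0 : mor B C) \oc f = 0.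
Proof. by apply: (addrI (0 \oc f)); rewrite -compmDl !addr0. Qed.

Lemma compm0 A B C (g : mor B C) : g \oc (0 : mor A B) = 0.
Proof. by apply: (addrI (g \oc 0)); rewrite -compmDr !addr0. Qed.

Lemma compmBl A B C (g g' : mor B C) (f : mor A B) :
  (g - g') \oc f = g \oc f - g' \oc f.
Proof. by apply: (addIr (g' \oc f)); rewrite -compmDl !subrK. Qed.

Lemma compmBr A B C (g : mor B C) (f f' : mor A B) :
  g \oc (f - f') = g \oc f - g \oc f'.
Proof. by apply: (addIr (g \oc f')); rewrite -compmDr !subrK. Qed.

Lemma compmNl A B C (g : mor B C) (f : mor A B) : (- g) \oc f = - (g \oc f).
Proof. by rewrite -sub0r compmBl comp0m sub0r. Qed.

Lemma mono_eq0 A B (f : mor A B) :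
  mono f <-> forall W (g : mor W A), f \oc g = 0 -> g = 0.
Proof.
split=> [fm W g fg0|fm W g h fgh]; first by apply: fm; rewrite fg0 compm0.
by apply: subr0_eq; apply: fm; rewrite compmBr fgh subrr.
Qed.

Lemma epi_eq0 A B (f : mor A B) :
  epi f <-> forall W (g : mor B W), g \oc f = 0 -> g = 0.
Proof.
split=> [fe W g gf0|fe W g h gfh]; first by apply: fe; rewrite gf0 comp0m.
by apply: subr0_eq; apply: fe; rewrite compmBl gfh subrr.
Qed.

Lemma mono_comp A B C (g : mor B C) (f : mor A B) :
  mono g -> mono f -> mono (g \oc f).
Proof. by move=> gm fm W x y; rewrite -!compmA => /gm /fm. Qed.

Lemma mono_of_comp A B C (g : mor B C) (f : mor A B) : mono (g \oc f) -> mono f.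
Proof. by move=> gfm W x y fxy; apply: gfm; rewrite -!compmA fxy. Qed.

Lemma idmor_mono A : mono (idmor A).
Proof. by move=> W x y; rewrite !compm1l. Qed.

Lemma essential_comp A B C (g : mor B C) (f : mor A B) :
  essential g -> essential f -> essential (g \oc f).
Proof. by move=> ge fe Z h; rewrite compmA => /fe /ge. Qed.

Lemma generator_neq0 U A B (f : mor A B) :
  is_generator U -> f <> 0 -> exists h : mor U A, f \oc h <> 0.
Proof.
move=> Ug fN0; apply: contrapT => /forallNP H; apply: fN0; apply: Ug => h.
by rewrite comp0m; apply: contrapT; apply: H.
Qed.

Lemma kernel_mono A B C (g : mor B C) (k : mor A B) : is_kernel g k -> mono k.
Proof.
move=> [gk0 kU] W x y kxy.
have [|s [_ sU]] := kU W (k \oc x); first by rewrite compmA gk0 comp0m.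
by rewrite -(sU x) // (sU y).
Qed.

Lemma kernel_lift A B C (g : mor B C) (k : mor A B) W (t : mor W B) :
  is_kernel g k -> g \oc t = 0 -> exists s, k \oc s = t.
Proof. by move=> [_ kU] /kU [s [<- _]]; exists s. Qed.

Lemma cokernel_epi A B C (f : mor A B) (q : mor B C) : is_cokernel f q -> epi q.
Proof.
move=> [qf0 qU] W x y xqy.
have [|s [_ sU]] := qU W (x \oc q); first by rewrite -compmA qf0 compm0.
by rewrite -(sU x) // (sU y).
Qed.

Lemma cokernel_desc A B C (f : mor A B) (q : mor B C) W (t : mor B W) :
  is_cokernel f q -> t \oc f = 0 -> exists s, s \oc q = t.
Proof. by move=> [_ qU] /qU [s [<- _]]; exists s. Qed.

End Preadditive.

(** * Pushouts, pullbacks and images in abelian categories *)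

Section Abelian.
Context {D : preaddCat} (abD : is_abelian D).
Implicit Types A B C E I P U W X Z : D.

Lemma mono_is_kernel A B C (f : mor A B) (q : mor B C) :
  mono f -> is_cokernel f q -> is_kernel q f.
Proof.
move=> /(abelian_mono abD) [Z [g [gf0 gU]]] qf; split=> [|W t qt0].
  by case: qf.
have [g' g'q] := cokernel_desc qf gf0.
by apply: gU; rewrite -g'q -compmA qt0 compm0.
Qed.

Lemma epi_is_cokernel A B C (q : mor B C) (k : mor A B) :
  epi q -> is_kernel q k -> is_cokernel k q.
Proof.
move=> /(abelian_epi abD) [Z [g [qg0 qU]]] kq; split=> [|W t tk0].
  by case: kq.
have [g' kg'] := kernel_lift kq qg0.
by apply: qU; rewrite -kg' compmA tk0 comp0m.
Qed.

(** [P] is the cokernel of [m], whose components are [f] and [- i]. As [i] is mono, so is [m], which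
    is then a kernel; thus what [j] kills comes from some [s] into [A], and its vanishing component
    in [B] forces [s = 0]. *)
Lemma pushout_mono A B E (i : mor A B) (f : mor A E) : mono i ->
  exists (P : D) (j : mor E P) (k : mor B P), mono j /\ j \oc f = k \oc i.
Proof.
move=> im.
have [S [i1 [i2 [p1 [p2 [p1i1 p2i2 p2i1 p1i2 _]]]]]] := abelian_biproduct abD E B.
pose m := i1 \oc f - i2 \oc i.
have p2m : p2 \oc m = - i.
  by rewrite compmBr !compmA p2i1 p2i2 comp0m compm1l sub0r.
have mm : mono m.
  apply/mono_eq0 => W g mg0; apply: (mono_eq0 i).1 => //.
  by rewrite -[i]opprK -p2m compmNl -compmA mg0 compm0 oppr0.
have [P [q qm]] := abelian_cokernel abD m.
exists P, (q \oc i1), (q \oc i2); split; last first.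
  by apply: subr0_eq; rewrite -!compmA -compmBr; case: qm.
apply/mono_eq0 => W g; rewrite -compmA => /(kernel_lift (mono_is_kernel mm qm)).
move=> [s ms].
have s0 : s = 0.
  apply: (mono_eq0 i).1 => //.
  by rewrite -[i]opprK -p2m compmNl -compmA ms compmA p2i1 comp0m oppr0.
by rewrite -[g]compm1l -p1i1 -compmA -ms s0 !compm0.
Qed.

(** Dual to [pushout_mono]: [P] is the kernel of a difference map out of the biproduct. *)
Lemma pullback_epi U I W (e : mor U I) (s : mor W I) : epi e ->
  exists (P : D) (p : mor P W) (r : mor P U), epi p /\ e \oc r = s \oc p.
Proof.
move=> ee.
have [S [i1 [i2 [p1 [p2 [p1i1 p2i2 p2i1 p1i2 _]]]]]] := abelian_biproduct abD U W.
pose m := e \oc p1 - s \oc p2.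
have mi1 : m \oc i1 = e.
  by rewrite compmBl -!compmA p1i1 p2i1 compm0 compm1r subr0.
have me : epi m.
  apply/epi_eq0 => Z g gm0; apply: (epi_eq0 e).1 => //.
  by rewrite -mi1 compmA gm0 comp0m.
have [P [k mk]] := abelian_kernel abD m.
exists P, (p2 \oc k), (p1 \oc k); split; last first.
  by apply: subr0_eq; rewrite !compmA -compmBl; case: mk.
apply/epi_eq0 => Z g; rewrite compmA => /(cokernel_desc (epi_is_cokernel me mk)).
move=> [t tm].
have t0 : t = 0.
  apply: (epi_eq0 e).1 => //.
  by rewrite -mi1 compmA tm -compmA p2i1 compm0.
by rewrite -[g]compm1r -p2i2 compmA -tm t0 !comp0m.
Qed.

(** Here [I] is the image of [d]. If [g] kills [e], then [d] factors through the kernel of [g], a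
    subobject of [B] and so the kernel of some [rho]. As [rho] kills [d], it factors through [q] and
    kills [m]; so that subobject is all of [I]. *)
Lemma kernel_cokernel_epi A B C I (d : mor A B) (q : mor B C) (m : mor I B)
    (e : mor A I) : is_cokernel d q -> is_kernel q m -> m \oc e = d -> epi e.
Proof.
move=> qd mq med; apply/epi_eq0 => G g ge0.
have [N [n ng]] := abelian_kernel abD g.
have [e' ne'] := kernel_lift ng ge0.
have mn_mono : mono (m \oc n) by apply: mono_comp; apply: kernel_mono; eassumption.
have [Z [rho rhoU]] := abelian_mono abD mn_mono.
have rhod : rho \oc d = 0.
  by rewrite -med -ne' compmA compmA -(compmA rho); case: rhoU => -> _; rewrite comp0m.
have [rho' rho'q] := cokernel_desc qd rhod.
have rhom : rho \oc m = 0.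
  by rewrite -rho'q -compmA; case: mq => -> _; rewrite compm0.
have [s mns] := kernel_lift rhoU rhom.
have ns : n \oc s = idmor I.
  by apply: (kernel_mono mq); rewrite compmA mns compm1r.
by rewrite -[g]compm1r -ns compmA; case: ng => -> _; rewrite comp0m.
Qed.

(** If [q] is a cokernel of [d], then [q \oc u] is not mono: otherwise [q] would be mono and [d]
    zero. So the image of [d] meets [X]; a pullback along the epi from [U] to this image, tested on
    [U], yields [r] and [x]. *)
Lemma essential_meet U X E (u : mor X E) (d : mor U E) :
  is_generator U -> essential u -> d <> 0 ->
  exists (r : mor U U) (x : mor U X), d \oc r = u \oc x /\ x <> 0.
Proof.
move=> Ug ue dN0.
have [C [q qd]] := abelian_cokernel abD d.
have : ~ mono (q \oc u).
  move=> /ue /mono_eq0 qm; apply: dN0; apply: qm; by case: qd.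
move=> /mono_eq0 /existsNP [W /existsNP [w /not_implyP [quw0 wN0]]].
have [I [m mq]] := abelian_kernel abD q.
have [e me] := kernel_lift mq qd.1.
have ee := kernel_cokernel_epi qd mq me.
have [s ms] : exists s, m \oc s = u \oc w by apply: kernel_lift mq _; rewrite compmA.
have [P [p [r [pe ers]]]] := pullback_epi s ee.
have wpN0 : w \oc p <> 0 by move=> wp0; apply: wN0; apply: (epi_eq0 p).1.
have [h wphN0] := generator_neq0 Ug wpN0.
exists (r \oc h), (w \oc p \oc h); split => //.
by rewrite -me !compmA -(compmA m) ers compmA ms.
Qed.

End Abelian.

(** * A bound for triangle-free colourings *)

Definition pick (A : Type) (a0 : A) (P : A -> Prop) : A :=
  if pselect (exists a, P a) is left Pex then sval (cid Pex) else a0.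

Lemma pickP (A : Type) (a0 : A) (P : A -> Prop) a : P a -> P (pick a0 P).
Proof.
by move=> Pa; rewrite /pick; case: pselect => [Pex|[]]; [case: cid|exists a].
Qed.

(** Index type for the bound: it depends on the colours only. A node describes a point by the points
    that see it in the colours [q], at most one for each [q]. *)
Inductive tree (Q : Type) : Type := Node of (Q -> option (tree Q)).

Section TriangleFree.
Variables (A Q : Type) (a0 : A) (c : A -> A -> Q).

Fixpoint tree_eval (t : tree Q) : A :=
  let: Node g := t in
  pick a0 (fun a => forall q,
    if g q is Some t' then tree_eval t' <> a /\ c (tree_eval t') a = q else True).

(* If a is not a value of tree_eval, let g choose, for each colour q, a tree t
   with c (tree_eval t) a = q, when there is one. Then b := tree_eval (Node g)
   sees the chosen points in the same colours as a does, and a triangle is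
   formed by a, b and the point chosen for the colour c b a. *)
Lemma triangle_free_tree_eval_surj :
  (forall x y z, x <> y -> y <> z -> x <> z ->
    c x y = c y z -> c x y = c x z -> False) ->
  forall a, exists t, tree_eval t = a.
Proof.
move=> cP a; apply: contrapT => /forallNP aN.
pose g q := if pselect (exists t, c (tree_eval t) a = q) is left tex
  then Some (sval (cid tex)) else None.
have gE q t : g q = Some t -> c (tree_eval t) a = q.
  by rewrite /g; case: pselect => // tex [<-]; case: cid.
pose realizes x := forall q, if g q is Some t then
  tree_eval t <> x /\ c (tree_eval t) x = q else True.
have evg : realizes (tree_eval (Node g)).
  apply: (@pickP _ _ realizes a) => q; case gq: (g q) => [t|] //.
  by split; [exact: aN|exact: gE].
pose q := c (tree_eval (Node g)) a.
(* The colour [q] does occur: [Node g] itself is a witness. *)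
have [t gq] : exists t, g q = Some t.
  rewrite /g; case: pselect => [tex|[]]; first by exists (sval (cid tex)).
  by exists (Node g).
have := evg q; rewrite gq => -[tNg ctg].
apply: (cP (tree_eval t) (tree_eval (Node g)) a) => //.
by rewrite ctg (gE _ _ gq).
Qed.

End TriangleFree.

(** * Zorn's lemma for small chains *)

Lemma well_founded_total (W : smallType) : exists lt : W -> W -> Prop,
  well_founded lt /\ forall x y, x <> y -> lt x y \/ lt y x.
Proof.
have [R Rwo] := @well_ordering_principle {classic W}.
exists (fun x y => ~~ R y x); split=> [x|x y xy].
  apply: contrapT => xN.
  pose A := [pred z : {classic W} | `[< ~ Acc (fun x y => ~~ R y x) z >]].
  have [|z [[/asboolP zN zmin] _]] := Rwo A; first by exists x; apply/asboolP.
  apply: zN; constructor => y Ryz; apply: contrapT => yN.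
  by move: Ryz; rewrite zmin //; apply/asboolP.
have [Rxy|Rxy] := boolP (R x y); last by right.
have [Ryx|Ryx] := boolP (R y x); last by left.
have Rrefl := wo_chain_reflexive (withinW Rwo (A := predT)).
(* If [R] holds both ways, [x] and [y] are both least in the pair, whose least element is unique. *)
have [|z [_ zU]] := Rwo (pred2 (x : {classic W}) y).
  by exists x; rewrite inE eqxx.
case: xy; rewrite -(zU x) ?(zU y) //; split; rewrite ?inE ?eqxx ?orbT // => t;
  by rewrite inE => /orP[] /eqP -> //; apply: Rrefl.
Qed.

Lemma Cantor (S : Type) (f : (S -> Prop) -> S) : ~ injective f.
Proof.
move=> finj; pose p s := exists q : S -> Prop, f q = s /\ ~ q s.
have pN : ~ p (f p) by move=> pfp; have [q [/finj -> qN]] := pfp.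
by apply: (pN); exists p.
Qed.

(* T may be large, e.g. made of objects of a category, but the chains to be
   bounded are indexed by small types. Without a maximal element, recursion along
   a well-ordering of S -> Prop would embed it into S. *)
Lemma small_chain_Zorn (T : Type) (le : T -> T -> Prop) (S : smallType)
    (inv : T -> S) (t0 : T) :
  (forall t, le t t) ->
  (forall r s t, le r s -> le s t -> le r t) ->
  (forall s t, le s t -> inv s = inv t -> le t s) ->
  (forall (J : smallType) (c : J -> T), J ->
    (forall i j, le (c i) (c j) \/ le (c j) (c i)) ->
    exists t, forall j, le (c j) t) ->
  exists t, forall s, le t s -> le s t.
Proof.
move=> le_refl le_trans le_inv le_ub; apply: contrapT => /forallNP no_max.
pose slt s t := le s t /\ ~ le t s.
have next t : exists s, slt t s.
  by have /existsNP[s /not_implyP] := no_max t; exists s.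
have [lt [lt_wf lt_tot]] := well_founded_total (S -> Prop).
(* Each value is to lie strictly above all earlier ones. [g_incr] shows that such a value exists, so
   the default [t0] is never taken. *)
pose step w (rec : forall w', lt w' w -> T) :=
  pick t0 (fun t => forall w' (lt_w : lt w' w), slt (rec w' lt_w) t).
pose g := Fix lt_wf (fun _ => T) step.
have gE w : g w = pick t0 (fun t => forall w', lt w' w -> slt (g w') t).
  rewrite /g Fix_eq // => x f h fh; congr step.
  by apply: functional_extensionality_dep => y; apply: functional_extensionality_dep.
have g_incr w w' : lt w' w -> slt (g w') (g w).
  move: w w'; apply: (well_founded_ind lt_wf) => w IH.
  pose P t := forall w', lt w' w -> slt (g w') t.
  suff [t Pt] : exists t, P t by rewrite (gE w); exact: (pickP t0 Pt).
  have [[w0 w0w]|/forallNP w_min] := pselect (exists w', lt w' w); last first.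
    by exists t0 => w' /w_min.
  pose J : smallType := {w' | lt w' w}.
  have [||t tub] := le_ub J (fun j => g (sval j)).
  - by exists w0.
  - move=> [i iw] [j jw] /=; have [->|ij] := pselect (i = j); first by left.
    by have [/(IH j jw)[]|/(IH i iw)[]] := lt_tot i j ij; [left|right].
  have [t' [tt' t'N]] := next t; exists t' => w' w'w.
  have w't := tub (exist _ w' w'w); split; first exact: le_trans tt'.
  by move=> t'w'; apply: t'N; apply: le_trans w't.
(* Two values with equal invariants would be equivalent by [le_inv], whereas [g] increases
   strictly. *)
apply: (@Cantor S (inv \o g)) => w w' /= inv_ww'; apply: contrapT => ww'.
have [/g_incr[le_ww' []]|/g_incr[le_ww' []]] := lt_tot _ _ ww'.
- exact: le_inv.
- exact: le_inv.
Qed.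

(** * Filtered colimits and colimits of chains *)

Definition preorder_cat (J : smallType) (r : J -> J -> Prop)
    (r_refl : forall i, r i i)
    (r_trans : forall i j k, r j k -> r i j -> r i k) : smallCat :=
  @SmallCat J r r_refl r_trans
    (fun _ _ _ _ _ _ _ => Prop_irrelevance _ _)
    (fun _ _ _ => Prop_irrelevance _ _) (fun _ _ _ => Prop_irrelevance _ _).

Section ConstantFunctor.
Context {D : preaddCat} (J : smallCat) (X : D).

Definition const_functor : functor J D :=
  @Functor J D (fun _ => X) (fun _ _ _ => idmor X) (fun _ => erefl)
    (fun _ _ _ _ _ => esym (compm1l (idmor X))).

Definition const_cocone : cocone const_functor :=
  @Cocone J D const_functor X (fun _ => idmor X) (fun _ _ _ => compm1l (idmor X)).

(** Two indices have a common upper bound, so all legs of a cocone agree. *)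
Lemma const_cocone_colimit : filtered J -> is_colimit const_cocone.
Proof.
move=> [[i0 _] ub _] c'.
have legE i j : leg c' i = leg c' j.
  have [k [f [g _]]] := ub i j.
  by rewrite -(legP c' f) -(legP c' g).
exists (leg c' i0); split=> [i|h hE]; first by rewrite compm1r.
by rewrite -(hE i0) compm1r.
Qed.

End ConstantFunctor.

Section Grothendieck.
Context {D : preaddCat} (groD : is_grothendieck D).
Implicit Types A B C E I P U W X Z : D.

Let abD := grothendieck_abelian groD.

(** The pointwise cokernels of [alpha] form a functor [H], so exactness applies to a short exact
    sequence of functors and shows [a] to be a kernel. *)
Lemma filtered_colimit_mono (J : smallCat) (F G : functor J D)
    (alpha : natTrans F G) (cF : cocone F) (cG : cocone G)
    (a : mor (apex cF) (apex cG)) :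
  filtered J -> is_colimit cF -> is_colimit cG ->
  (forall i, mono (alpha i)) ->
  (forall i, a \oc leg cF i = leg cG i \oc alpha i) -> mono a.
Proof.
move=> Jf cFP cGP am aE.
pose Hob i := sval (cid (abelian_cokernel abD (alpha i))).
have Hex i : exists q : mor (G i) (Hob i), is_cokernel (alpha i) q.
  exact: svalP (cid (abelian_cokernel abD (alpha i))).
pose q i := sval (cid (Hex i)).
have qP i : is_cokernel (alpha i) (q i) := svalP (cid (Hex i)).
have Hmap_ex i j (f : shom i j) :
    exists h : mor (Hob i) (Hob j), h \oc q i = q j \oc fmap G f.
  apply: cokernel_desc (qP i) _.
  by rewrite -compmA -ntmP compmA; case: (qP j) => -> _; rewrite comp0m.
pose Hmap i j f := sval (cid (Hmap_ex i j f)).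
have HmapE i j (f : shom i j) : Hmap i j f \oc q i = q j \oc fmap G f.
  exact: svalP (cid (Hmap_ex i j f)).
have qe i := cokernel_epi (qP i).
have Hid i : Hmap i i (sid i) = idmor (Hob i).
  by apply: (qe i); rewrite HmapE fmap_id compm1l compm1r.
have Hcomp i j k (g : shom j k) (f : shom i j) :
    Hmap i k (scomp g f) = Hmap j k g \oc Hmap i j f.
  by apply: (qe i); rewrite HmapE fmap_comp -compmA HmapE !compmA HmapE.
pose H : functor J D := Functor Hid Hcomp.
pose beta : natTrans G H :=
  @NatTrans J D G H q (fun i j f => esym (HmapE i j f)).
have [cH cHP] := grothendieck_cocomplete groD H.
have legb i j (f : shom i j) :
    (leg cH j \oc q j) \oc fmap G f = leg cH i \oc q i.
  by rewrite -compmA -HmapE compmA (legP cH f).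
have [b [bE _]] := cGP (Cocone legb).
have [|ab _] := grothendieck_exact groD Jf (beta := beta) _ cFP cGP cHP aE bE.
  by move=> i; split; [exact: mono_is_kernel (am i) (qP i)|exact: qP].
exact: kernel_mono ab.
Qed.

(* A chain of objects, given by its transition morphisms: tr i j v says that v
   is the transition from E i to E j. *)
Lemma chain_colimit (J : smallType) (E : J -> D)
    (tr : forall i j, mor (E i) (E j) -> Prop) : J ->
  (forall i, tr i i (idmor (E i))) ->
  (forall i j k g f, tr j k g -> tr i j f -> tr i k (g \oc f)) ->
  (forall i j f g, tr i j f -> tr i j g -> f = g) ->
  (forall i j, (exists v, tr i j v) \/ (exists v, tr j i v)) ->
  exists (C : D) (l : forall i, mor (E i) C),
  [/\ forall i j v, tr i j v -> l j \oc v = l i,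
      forall Z (f g : mor C Z), (forall i, f \oc l i = g \oc l i) -> f = g,
      forall Z (f : mor C Z), (forall i, mono (f \oc l i)) -> mono f
    & forall X (x : forall i, mor X (E i)),
        (forall i j v, tr i j v -> v \oc x i = x j) ->
        (forall i, mono (x i)) -> forall i, mono (l i \oc x i)].
Proof.
move=> j0 tr_id tr_comp tr_uniq tr_tot.
pose r i j := exists v, tr i j v.
have r_refl i : r i i by exists (idmor (E i)).
have r_trans i j k : r j k -> r i j -> r i k.
  by move=> [g jkg] [f ijf]; exists (g \oc f); apply: tr_comp jkg ijf.
pose JC : smallCat := preorder_cat r_refl r_trans.
have JCf : filtered JC.
  split; first by exists j0.
  - move=> i j; have [ij|ji] := tr_tot i j.
      by exists j, ij, (r_refl j).
    by exists i, (r_refl i), ji.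
  - by move=> i j f g; exists j, (r_refl j); exact: (@Prop_irrelevance (r i j)).
(* By [tr_uniq] the chosen transitions are functorial. *)
pose tm i j (ij : r i j) := sval (cid ij).
have tmP i j (ij : r i j) : tr i j (tm i j ij) := svalP (cid ij).
have tm_id i : tm i i (r_refl i) = idmor (E i) by exact: tr_uniq.
have tm_comp i j k (g : r j k) (f : r i j) :
    tm i k (r_trans i j k g f) = tm j k g \oc tm i j f.
  by apply: tr_uniq => //; apply: tr_comp.
pose F : functor JC D := @Functor JC D E tm tm_id tm_comp.
have [cF cFP] := grothendieck_cocomplete groD F.
exists (apex cF), (leg cF); split.
- move=> i j v ijv; have ij : r i j by exists v.
  by rewrite (tr_uniq _ _ _ _ ijv (tmP _ _ ij)); exact: (@legP _ _ F cF i j ij).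
- move=> Z f g fg.
  have glegP i j (ij : @shom JC i j) :
      (g \oc leg cF j) \oc fmap F ij = g \oc leg cF i.
    by rewrite -compmA legP.
  have [h [_ hU]] := cFP (Cocone glegP).
  by rewrite -(hU f) // (hU g).
- move=> Z f fm.
  (* [f] is induced by a transformation to the constant functor at [Z], whose colimit is [Z]. *)
  have flegP i j (ij : @shom JC i j) :
      (f \oc leg cF j) \oc fmap F ij = idmor Z \oc (f \oc leg cF i).
    by rewrite compm1l -compmA legP.
  pose alpha : natTrans F (const_functor JC Z) :=
    @NatTrans JC D F (const_functor JC Z) _ flegP.
  apply: (@filtered_colimit_mono JC F _ alpha cF (const_cocone JC Z)) => //.
    exact: const_cocone_colimit.
  by move=> i; rewrite compm1l.
- move=> X x xE xm i.
  (* Dually, [l i \oc x i] is induced by a transformation from the constant functor at [X]. *)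
  have xP j k (jk : @shom JC j k) :
      x k \oc fmap (const_functor JC X) jk = fmap F jk \oc x j.
    by rewrite compm1r; apply/esym/xE/tmP.
  pose alpha : natTrans (const_functor JC X) F :=
    @NatTrans JC D (const_functor JC X) F x xP.
  apply: (@filtered_colimit_mono JC _ F alpha (const_cocone JC X) cF) => //.
    exact: const_cocone_colimit.
  move=> j; rewrite compm1r /=.
  have [k [f [g _]]] := filtered_ub JCf i j.
  by rewrite -(legP cF f) -(legP cF g) -!compmA -!xP !compm1r.
Qed.

(* Colour a pair of morphisms a, b : U -> E with the partial map from End(U) to
   Hom(U, X) induced by a - b. On a triangle x, y, z of colour phi we would get
   phi = phi + phi, as x - z = (x - y) + (y - z), whereas phi <> 0 because X is
   essential in E. *)
Lemma essential_extension_bound U X : is_generator U ->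
  exists K : smallType, forall E (u : mor X E), mono u -> essential u ->
  exists s : K -> mor U E, forall h, exists k, s k = h.
Proof.
move=> Ug; exists (tree (mor U U -> mor U X -> Prop)) => E u um ue.
pose c (a b : mor U E) (r : mor U U) (x : mor U X) := (a - b) \oc r = u \oc x.
exists (tree_eval 0 c); apply: triangle_free_tree_eval_surj => x y z xy _ _ cxyz cxy.
have [|r [w [rw]]] := essential_meet abD Ug ue (d := x - y).
  by move/subr0_eq.
have yzr : (y - z) \oc r = u \oc w by rewrite -/(c y z r w) -cxyz.
have xzr : (x - z) \oc r = u \oc w by rewrite -/(c x z r w) -cxy.
apply; apply: (mono_eq0 u).1 => //.
apply: (addrI (u \oc w)); rewrite addr0 -[in RHS]xzr.
by rewrite -{1}rw -yzr -compmDl addrA subrK.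
Qed.

(** * Maximal essential extensions *)

Section Hull.
Variables (U X : D) (K : smallType).
Hypothesis Ug : is_generator U.
Hypothesis KP : forall E (u : mor X E), mono u -> essential u ->
  exists s : K -> mor U E, forall h, exists k, s k = h.

(* The labels make the comparison morphisms between extensions unique. *)
Record labelled_extension := LabelledExtension {
  ext_ob : D;
  ext_in : mor X ext_ob;
  ext_label : mor U ext_ob -> K * (K -> Prop);
  ext_mono : mono ext_in;
  ext_essential : essential ext_in;
  ext_label_inj : forall g h, ext_label g = ext_label h -> g = h }.

Arguments ext_label : clear implicits.
Implicit Types s t : labelled_extension.

Definition ext_map s t (v : mor (ext_ob s) (ext_ob t)) : Prop :=
  v \oc ext_in s = ext_in t /\ forall h, ext_label t (v \oc h) = ext_label s h.

Lemma ext_map_uniq s t (v w : mor (ext_ob s) (ext_ob t)) :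
  ext_map v -> ext_map w -> v = w.
Proof.
move=> [_ vl] [_ wl]; apply: Ug => h.
by apply: (@ext_label_inj t); rewrite vl wl.
Qed.

Lemma ext_map_id t : ext_map (idmor (ext_ob t)).
Proof. by split=> [|h]; rewrite compm1l. Qed.

Lemma ext_map_comp r s t (w : mor (ext_ob s) (ext_ob t))
    (v : mor (ext_ob r) (ext_ob s)) :
  ext_map w -> ext_map v -> ext_map (w \oc v).
Proof.
by move=> [wu wl] [vu vl]; split=> [|h]; rewrite -compmA ?vu // wl vl.
Qed.

Lemma ext_map_mono s t (v : mor (ext_ob s) (ext_ob t)) : ext_map v -> mono v.
Proof. by move=> [vu _]; apply: (@ext_essential s); rewrite vu; apply: ext_mono. Qed.

(* The labels in use are at most as many as K, so that by Cantor's diagonal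
   argument some slice K * {p} contains none of them. *)
Lemma extend_labels E (u : mor X E) (R : mor U E -> K * (K -> Prop) -> Prop) :
  mono u -> essential u ->
  (forall h b b', R h b -> R h b' -> b = b') ->
  (forall h h' b, R h b -> R h' b -> h = h') ->
  exists t (f : mor E (ext_ob t)),
    f \oc u = ext_in t /\ forall h b, R h b -> ext_label t (f \oc h) = b.
Proof.
move=> um ue Rfun Rinj; have [s sP] := KP um ue.
(* The diagonal set: at [k] it differs from the second component of any label prescribed for
   [s k]. *)
pose p k := forall b, R (s k) b -> ~ b.2 k.
have pN h k : ~ R h (k, p).
  have [k' <-] := sP h => Rk; have Np : ~ p k' by move=> pk; apply: (pk _ Rk).
  by apply: (Np) => b Rb; rewrite -(Rfun _ _ _ Rk Rb).
(* Where nothing is prescribed, the label is [(k, p)] with [s k = h], from which [h] can be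
   recovered. *)
pose l h := if pselect (exists b, R h b) is left Rh then sval (cid Rh)
  else (sval (cid (sP h)), p).
have lR h b : R h b -> l h = b.
  rewrite /l => Rb; case: pselect => [Rh|[]]; last by exists b.
  by apply: Rfun Rb; case: cid.
have lN h : (forall b, ~ R h b) -> l h = (sval (cid (sP h)), p).
  by rewrite /l; case: pselect => // -[b Rb] /(_ b).
have linj g h : l g = l h -> g = h.
  have [[b Rb]|/forallNP Rg] := pselect (exists b, R g b);
  have [[b' Rb']|/forallNP Rh] := pselect (exists b, R h b).
  - by rewrite (lR _ _ Rb) (lR _ _ Rb') => bb'; apply: Rinj Rb _; rewrite bb'.
  - by rewrite (lR _ _ Rb) (lN _ Rh) => bE; rewrite bE in Rb; case: (pN _ _ Rb).
  - by rewrite (lR _ _ Rb') (lN _ Rg) => bE; rewrite -bE in Rb'; case: (pN _ _ Rb').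
  - rewrite !lN //; case: cid => k /= <-; case: cid => k' /= <-.
    by case=> ->.
exists (LabelledExtension um ue linj), (idmor E).
by split=> [|h b /lR]; rewrite compm1l.
Qed.

(** The invariant for Zorn's lemma is the set of labels in use. If a comparison [v] leaves it
    unchanged, every morphism from [U] lifts along [v], so [v] is epi as well as mono, hence
    invertible. *)
Lemma maximal_labelled_extension : exists t, forall s (v : mor (ext_ob t) (ext_ob s)),
  ext_map v -> exists w : mor (ext_ob s) (ext_ob t), ext_map w.
Proof.
pose le s t := exists v : mor (ext_ob s) (ext_ob t), ext_map v.
have ue : essential (idmor X) by move=> Z f; rewrite compm1r.
have [//|//|t0 _] := @extend_labels X _ (fun _ _ => False) (@idmor_mono _ X) ue.
pose inv t (b : K * (K -> Prop)) := exists h, ext_label t h = b.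
have [t|r s t [v rs] [w st]|s t [v st] inv_st|J c j0 c_tot|t tmax] :=
  small_chain_Zorn (le := le) (inv := inv) t0.
- by exists (idmor _); apply: ext_map_id.
- by exists (w \oc v); apply: ext_map_comp.
- have vsurj (h : mor U (ext_ob t)) : exists g, v \oc g = h.
    have : inv s (ext_label t h) by rewrite inv_st; exists h.
    by move=> [g gh]; exists g; apply: (@ext_label_inj t); rewrite st.2.
  have ve : epi v.
    apply/epi_eq0 => W g gv0; apply: Ug => h; have [h' <-] := vsurj h.
    by rewrite compmA gv0 !comp0m.
  have [C [q vq]] := abelian_cokernel abD v.
  have q0 : q = 0 by apply: (epi_eq0 v).1 ve _ _ _; case: vq.
  have [|w vw] := kernel_lift (t := idmor _) (mono_is_kernel abD (ext_map_mono st) vq).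
    by rewrite q0 comp0m.
  have wv : w \oc v = idmor _.
    by apply: (ext_map_mono st); rewrite compmA vw compm1l compm1r.
  exists w; split=> [|h]; first by rewrite -st.1 compmA wv compm1l.
  by rewrite -st.2 compmA vw compm1l.
- have [C [l [lc _ lmono lx]]] := chain_colimit (E := ext_ob \o c) j0
    (fun i => ext_map_id (c i)) (fun i j k => @ext_map_comp (c i) (c j) (c k))
    (fun i j => @ext_map_uniq (c i) (c j)) c_tot.
  pose u := l j0 \oc ext_in (c j0).
  have uE i : l i \oc ext_in (c i) = u.
    have [[v vm]|[v vm]] := c_tot i j0.
      by rewrite /u -vm.1 compmA lc.
    by rewrite /u -vm.1 compmA lc.
  have um : mono u.
    apply: (lx X (fun i => ext_in (c i))) => [i j v [] //|i].
    exact: ext_mono.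
  have uess : essential u.
    move=> Z f fum; apply: lmono => i; apply: (@ext_essential (c i)).
    by rewrite -compmA uE.
  have lm i : mono (l i) by apply: (@ext_essential (c i)); rewrite uE.
  (* Labels inherited from the stages. They may be partial, since a morphism from [U] to [C] need
     not factor through a stage; [extend_labels] supplies the others. *)
  pose R (h : mor U C) b := exists i (g : mor U (ext_ob (c i))),
    l i \oc g = h /\ ext_label (c i) g = b.
  have Rcmp h b h' b' : R h b -> R h' b' -> exists i (g g' : mor U (ext_ob (c i))),
      [/\ l i \oc g = h, ext_label (c i) g = b,
          l i \oc g' = h' & ext_label (c i) g' = b'].
    move=> [i [g [<- <-]]] [i' [g' [<- <-]]].
    have [[v vm]|[v vm]] := c_tot i i'.
      by exists i', (v \oc g), g'; rewrite compmA lc // vm.2.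
    by exists i, g, (v \oc g'); rewrite compmA lc // vm.2.
  have [h b b' Rb Rb'|h h' b Rb Rb'|t [f [fu fl]]] := extend_labels (R := R) um uess.
  + have [i [g [g' [gh <- gh' <-]]]] := Rcmp _ _ _ _ Rb Rb'.
    by rewrite (lm i _ g g') // gh.
  + have [i [g [g' [<- gb <- gb']]]] := Rcmp _ _ _ _ Rb Rb'.
    by rewrite (@ext_label_inj (c i) g g') // gb.
  + exists t => j; exists (f \oc l j); split=> [|h]; first by rewrite -compmA uE.
    by rewrite -compmA; apply: fl; exists j, h.
- by exists t => s v tv; apply: tmax; exists v.
Qed.

(** Labels carried along [w] make the larger extension comparable with the maximal one. Maximality
    gives a comparison back, and the composite is the identity since comparisons are unique. *)
Lemma maximal_essential_extension : exists E (u : mor X E),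
  [/\ mono u, essential u & forall E' (w : mor E E'), mono w -> essential w ->
      exists r, r \oc w = idmor E].
Proof.
have [t tmax] := maximal_labelled_extension.
exists (ext_ob t), (ext_in t); split; [exact: ext_mono|exact: ext_essential|].
move=> E' w wm we.
pose R h b := exists g, w \oc g = h /\ ext_label t g = b.
have [||s [f [fu fl]]] := extend_labels (R := R)
  (mono_comp wm (@ext_mono t)) (essential_comp we (@ext_essential t)).
- move=> h b b' [g [gh <-]] [g' [gh' <-]].
  by rewrite (wm _ g g') // gh.
- move=> h h' b [g [<- gb]] [g' [<- gb']].
  by rewrite (@ext_label_inj t g g') // gb.
have tfw : @ext_map t s (f \oc w).
  split=> [|h]; first by rewrite -compmA.
  by rewrite -compmA; apply: fl; exists h.
have [v vm] := tmax s _ tfw.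
exists (v \oc f); rewrite -compmA; apply: (@ext_map_uniq t t).
  exact: ext_map_comp vm tfw.
exact: ext_map_id.
Qed.

End Hull.

(** * Essential quotients and injectivity *)

Section EssentialQuotient.
Variables (U A P : D) (j : mor A P).
Hypotheses (Ug : is_generator U) (jm : mono j).

(** The quotients of [P] by subobjects that meet [A] trivially. *)
Record disjoint_quotient := DisjointQuotient {
  quo_ob : D;
  quo_map : mor P quo_ob;
  quo_epi : epi quo_map;
  quo_mono : mono (quo_map \oc j) }.

Implicit Types s t : disjoint_quotient.

(** The invariant for Zorn's lemma is the set of morphisms from [U] that the quotient map kills; as
    [U] is a generator, it determines the kernel. *)
Lemma essential_quotient : exists Q (q : mor P Q), mono (q \oc j) /\ essential (q \oc j).
Proof.
pose tr s t (v : mor (quo_ob s) (quo_ob t)) := v \oc quo_map s = quo_map t.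
pose le s t := exists v, tr s t v.
have tr_id t : tr t t (idmor _) by rewrite /tr compm1l.
have tr_comp r s t w v : tr s t w -> tr r s v -> tr r t (w \oc v).
  by rewrite /tr => <- <-; rewrite compmA.
have tr_uniq s t v w : tr s t v -> tr s t w -> v = w.
  by rewrite /tr => <- /esym; apply: quo_epi.
pose inv t (h : mor U P) := quo_map t \oc h = 0.
have t0 : disjoint_quotient.
  exists P (idmor P); last by rewrite compm1l.
  by move=> W x y; rewrite !compm1r.
have [t|r s t [v rs] [w st]|s t [v st] inv_st|J c j0 c_tot|t tmax] :=
  small_chain_Zorn (le := le) (inv := inv) t0.
- by exists (idmor _).
- by exists (w \oc v); apply: tr_comp.
- have [N [k tk]] := abelian_kernel abD (quo_map t).
  have sk0 : quo_map s \oc k = 0.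
    apply: Ug => h; rewrite comp0m -compmA.
    have : inv t (k \oc h) by rewrite /inv compmA; case: tk => -> _; rewrite comp0m.
    by rewrite -inv_st.
  by apply: cokernel_desc (epi_is_cokernel abD (@quo_epi t) tk) sk0.
- have [C [l [lc luniq _ lx]]] := chain_colimit (E := quo_ob \o c) j0
    (fun i => tr_id (c i)) (fun i j k => @tr_comp (c i) (c j) (c k))
    (fun i j => @tr_uniq (c i) (c j)) c_tot.
  pose q := l j0 \oc quo_map (c j0).
  have qE i : l i \oc quo_map (c i) = q.
    by have [[v vm]|[v vm]] := c_tot i j0; rewrite /q -vm compmA lc.
  have qe : epi q.
    move=> W x y xyq; apply: luniq => i; apply: (@quo_epi (c i)).
    by rewrite -!compmA qE.
  have qjm : mono (q \oc j).
    rewrite /q -compmA; apply: (lx A (fun i => quo_map (c i) \oc j)) => [i i' v <-|i].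
      by rewrite compmA.
    exact: quo_mono.
  by exists (DisjointQuotient qe qjm) => i; exists (l i); apply: qE.
- exists (quo_ob t), (quo_map t); split=> [|Z f fm]; first exact: quo_mono.
  (* The coimage [e] of [f] gives a further quotient in which [A] still embeds. By maximality [e]
     has a retraction, so the kernel [k] of [f] vanishes. *)
  have [N [k fk]] := abelian_kernel abD f.
  have [Q [e ke]] := abelian_cokernel abD k.
  have [f' f'e] := cokernel_desc ke fk.1.
  have qe : epi (e \oc quo_map t).
    by move=> W x y; rewrite !compmA => /(@quo_epi t) /(cokernel_epi ke).
  have qm : mono ((e \oc quo_map t) \oc j).
    by apply: (@mono_of_comp _ _ _ _ f'); rewrite !compmA f'e -compmA.
  have [|v vm] := tmax (DisjointQuotient qe qm); first by exists e.
  have ve : v \oc e = idmor _.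
    by apply: (@quo_epi t); rewrite -compmA compm1l; apply: vm.
  apply/mono_eq0 => W g fg0; have [h <-] := kernel_lift fk fg0.
  by rewrite -[k]compm1l -ve -(compmA v); case: ke => -> _; rewrite compm0 comp0m.
Qed.

End EssentialQuotient.

Lemma injective_of_essential_split U E : is_generator U ->
  (forall E' (w : mor E E'), mono w -> essential w -> exists r, r \oc w = idmor E) ->
  injective_object E.
Proof.
move=> Ug Esplit A B i im f.
have [P [j [k [jm jf]]]] := pushout_mono abD f im.
have [Q [q [qjm qje]]] := essential_quotient Ug jm.
have [r rqj] := Esplit Q _ qjm qje.
exists (r \oc q \oc k).
by rewrite -compmA -jf !compmA -(compmA r) rqj compm1l.
Qed.

End Grothendieck.

Theorem corollary5p5 (D : preaddCat) (D_grothendieck : is_grothendieck D) (X : D) :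
  exists (E : D) (u : mor X E), injective_hull u.
Proof.
have [U Ug] := grothendieck_generator D_grothendieck.
have [K KP] := essential_extension_bound D_grothendieck X Ug.
have [E [u [um ue Esplit]]] := maximal_essential_extension D_grothendieck Ug KP.
by exists E, u; split => //; apply: injective_of_essential_split Ug Esplit.
Qed.
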